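(* Let $Q=\mathbb{Q}\cap[0,1]$. The algorithm described in the context, run with any choice of the ordering $Q_Y$ and any admissible step sequence, produces a bijection $f:Q\to Q$ with the Costas property; in this way the algorithm produces infinitely many bijections $f:Q\to Q$ with the Costas property.
   Context: Costas property over $Q=\mathbb{Q}\cap[0,1]$: a bijection $f:Q\to Q$ has the Costas property iff the multiset $\{(x-y,f(x)-f(y)):x,y\in Q,\ y<x\}$ is actually a set, i.e. all of its elements are distinct. Orderings. $Q_X$ is the set $Q$ ordered first by increasing denominator and then by increasing numerator (fractions in lowest terms): $0,1,\frac12,\frac13,\frac23,\frac14,\frac34,\frac15,\dots$; its elements in this order are $x_0,x_1,x_2,\dots$. $Q_Y$ is the set $Q$ with any arbitrary but fixed ordering in which each element is preceded by only finitely many elements; its elements in this order are $y_0,y_1,y_2,\dots$. Below, $\inf$ of a subset of $Q_X$ (resp. $Q_Y$) means its first element with respect to the ordering of $Q_X$ (resp. $Q_Y$), while $\operatorname{sgn}(x'-x)$ and differences are the usual ones of rational numbers. Algorithm. It consists of three kinds of steps. Initialization: choose $f(x_0)=y_0$; set $Q'_Y\leftarrow Q_Y-\{y_0\}$, $Q'_X\leftarrow Q_X-\{x_0\}$, $X\leftarrow\{x_0\}$, $Y\leftarrow\{y_0\}$, $D\leftarrow\emptyset$. Find $x$ for $y$: set $Q_{X,\mathrm{av}}\leftarrow Q'_X$, $x\leftarrow\inf Q_{X,\mathrm{av}}$, $y\leftarrow\inf Q'_Y$. While the (multi)set $\{\operatorname{sgn}(x'-x)(x'-x,f(x')-y):x'\in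 X\}\cup D$ is actually a multiset (has a repeated element), set $Q_{X,\mathrm{av}}\leftarrow Q_{X,\mathrm{av}}-\{x\}$, $x\leftarrow\inf Q_{X,\mathrm{av}}$, and repeat. Then set $f(x)=y$, $D\leftarrow\{\operatorname{sgn}(x'-x)(x'-x,f(x')-y):x'\in X\}\cup D$, $Q'_Y\leftarrow Q'_Y-\{y\}$, $Q'_X\leftarrow Q'_X-\{x\}$, $X\leftarrow X\cup\{x\}$, $Y\leftarrow Y\cup\{y\}$. Find $y$ for $x$: set $Q_{Y,\mathrm{av}}\leftarrow Q'_Y$, $y\leftarrow\inf Q_{Y,\mathrm{av}}$, $x\leftarrow\inf Q'_X$. While the (multi)set $\{\operatorname{sgn}(x'-x)(x'-x,f(x')-y):x'\in X\}\cup D$ is actually a multiset (has a repeated element), set $Q_{Y,\mathrm{av}}\leftarrow Q_{Y,\mathrm{av}}-\{y\}$, $y\leftarrow\inf Q_{Y,\mathrm{av}}$, and repeat. Then set $f(x)=y$ and update $D,Q'_Y,Q'_X,X,Y$ exactly as in the previous step. The unions with $D$ are multiset unions. The algorithm is supplied with an infinite step sequence before execution; a step sequence is admissible if Initialization is run first and only once, and neither ''Find $x$ for $y$'' nor ''Find $y$ for $x$'' is run infinitely many times in a row. *)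

(* Defs.v *)
From mathcomp Require Import all_boot all_order all_algebra.
From mathcomp Require Import boolp classical_sets functions cardinality.

Set Implicit Arguments.
Unset Strict Implicit.
Unset Printing Implicit Defensive.

Import Order.TTheory GRing.Theory Num.Theory.
Local Open Scope classical_set_scope.
Local Open Scope ring_scope.

Definition Q01 := {q : rat | 0 <= q <= 1}.

(* A multiset given as an indexed family is a set iff the family is injective
   on its index set; here the indices are the pairs (x, y) with y < x. *)
Definition costas (f : Q01 -> Q01) : Prop :=
  set_inj [set p : Q01 * Q01 | val p.2 < val p.1]
    (fun p => (val p.1 - val p.2, val (f p.1) - val (f p.2))).

Definition leX : rel Q01 := fun p q =>
  (denq (val p) < denq (val q)) ||
  (denq (val p) == denq (val q)) && (numq (val p) <= numq (val q)).

Definition admissible_order (le : rel Q01) : Prop :=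
  [/\ antisymmetric le, transitive le, total le &
      forall q, finite_set [set p | le p q]].

Definition is_first (le : rel Q01) (A : set Q01) (q : Q01) : Prop :=
  A q /\ forall p, A p -> le q p.

(* The state of the algorithm: [graph] lists the pairs (x', f(x')) assigned so
   far, and [diffs] is the multiset D, as a list with multiplicities.  The other
   variables of the algorithm (X, Y, Q'_X, Q'_Y) are determined by [graph]. *)
Record state := State { graph : seq (Q01 * Q01); diffs : seq (rat * rat) }.

Definition domX (s : state) : seq Q01 := [seq p.1 | p <- graph s].
Definition imgY (s : state) : seq Q01 := [seq p.2 | p <- graph s].
Definition restX (s : state) : set Q01 := [set x | x \notin domX s].
Definition restY (s : state) : set Q01 := [set y | y \notin imgY s].

Definition new_diffs (s : state) (x y : Q01) : seq (rat * rat) :=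
  [seq (Num.sg (val p.1 - val x) * (val p.1 - val x),
        Num.sg (val p.1 - val x) * (val p.2 - val y)) | p <- graph s].

Definition conflict (s : state) (x y : Q01) : bool :=
  ~~ uniq (new_diffs s x y ++ diffs s).

Definition assign (s : state) (x y : Q01) : state :=
  State ((x, y) :: graph s) (new_diffs s x y ++ diffs s).

(* [search le bad av r]: the while loop started with the available set [av] and
   with [inf av] as candidate, discarding the candidate as long as [bad] holds
   of it, terminates with candidate [r]. *)
Inductive search (le : rel Q01) (bad : pred Q01) : set Q01 -> Q01 -> Prop :=
| search_stop av q :
    is_first le av q -> ~~ bad q -> search le bad av q
| search_next av q r :
    is_first le av q -> bad q -> search le bad (av `\ q) r ->
    search le bad av r.

Inductive kind := Initialization | FindXforY | FindYforX.

Definition exec (leY : rel Q01) (k : kind) (s s' : state) : Prop :=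
  match k with
  | Initialization => exists x y,
      [/\ is_first leX setT x, is_first leY setT y &
          s' = State [:: (x, y)] [::]]
  | FindXforY => exists x y,
      [/\ is_first leY (restY s) y,
          search leX (fun z => conflict s z y) (restX s) x &
          s' = assign s x y]
  | FindYforX => exists x y,
      [/\ is_first leX (restX s) x,
          search leY (fun z => conflict s x z) (restY s) y &
          s' = assign s x y]
  end.

Definition admissible_steps (sigma : nat -> kind) : Prop :=
  [/\ forall n, sigma n = Initialization <-> n = 0%N,
      ~ (exists N, forall n, (N <= n)%N -> sigma n = FindXforY) &
      ~ (exists N, forall n, (N <= n)%N -> sigma n = FindYforX)].

(* [S n] is the state before step [n].  A run in this sense exists only if every
   while loop met along the way terminates. *)
Definition is_run (leY : rel Q01) (sigma : nat -> kind) (S : nat -> state) :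
    Prop :=
  S 0%N = State [::] [::] /\ forall n, exec leY (sigma n) (S n) (S n.+1).

Definition produces (leY : rel Q01) (sigma : nat -> kind) (f : Q01 -> Q01) :
    Prop :=
  exists2 S, is_run leY sigma S &
    forall x y, f x = y <-> exists n, (x, y) \in graph (S n).

(* Main.v *)
Require Import Defs.
From mathcomp Require Import all_boot all_order all_algebra.
From mathcomp Require Import boolp classical_sets functions cardinality.
From mathcomp Require Import lra zify.

Set Implicit Arguments.
Unset Strict Implicit.
Unset Printing Implicit Defensive.

Import Order.TTheory GRing.Theory Num.Theory.
Local Open Scope classical_set_scope.
Local Open Scope ring_scope.

(** For fixed [y], a conflict of a candidate [x] with the current graph forces
    either [2x = p1 + q1] for two points [p], [q] of the graph, or [x = p1 + d1]
    or [x = p1 - d1] for a point [p] and a difference [d] in [D]; this excludes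
    finitely many [x], and the same holds with the coordinates exchanged.  So
    every while loop terminates.  Each rational is preceded by finitely many
    others and each kind of step recurs infinitely often, so every [x] and
    every [y] gets assigned, and the absence of repetitions in [D] is the Costas
    property in the limit.  Infinitely many bijections arise because [y_0], the
    value at [x_0], can be prescribed arbitrarily. *)

(** * First elements and the search loop *)

Lemma first_unique (le : rel Q01) (A : set Q01) (p q : Q01) :
  antisymmetric le -> is_first le A p -> is_first le A q -> p = q.
Proof.
by move=> le_anti [Ap minp] [Aq minq]; apply: le_anti; rewrite minp // minq.
Qed.

Lemma first_exists (le : rel Q01) (A : set Q01) :
  admissible_order le -> A !=set0 -> exists q, is_first le A q.
Proof.
move=> [_ le_trans le_total le_fin] [a Aa].
have le_refl x : le x x by have := le_total x x; rewrite orbb.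
have min_seq (l : seq Q01) : exists2 m, A m & forall p, A p -> p \in l -> le m p.
  elim: l => [|b l [m Am minm]]; first by exists a.
  have [Ab|nAb] := pselect (A b); last first.
    exists m => // p Ap; rewrite inE => /orP[/eqP pb|]; last exact: minm.
    by case: nAb; rewrite -pb.
  have [mb|bm] := orP (le_total m b).
    by exists m => // p Ap; rewrite inE => /orP[/eqP->//|]; apply: minm.
  exists b => // p Ap; rewrite inE => /orP[/eqP->//|lp].
  exact: le_trans bm (minm p Ap lp).
(* Only the finitely many predecessors of [a] compete with [a]; by totality every other member of
   [A] comes after [a], hence after the minimum [m] of [a :: l]. *)
have /finite_seqP[l la] := le_fin a.
have [m Am minm] := min_seq (a :: l).
exists m; split=> // p Ap.
have [ap|pa] := orP (le_total a p).
  by apply: (le_trans a) ap; apply: minm => //; rewrite mem_head.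
apply: minm => //; rewrite inE; apply/orP; right.
by have : [set p | le p a] p by []; rewrite la.
Qed.

Lemma search_mem (le : rel Q01) (bad : pred Q01) (av : set Q01) (r : Q01) :
  search le bad av r -> av r /\ ~~ bad r.
Proof. by elim=> {av r} [av q [] //|av q r _ _ _ [[]]]. Qed.

Lemma search_unique (le : rel Q01) (bad : pred Q01) (av : set Q01) (r r' : Q01) :
  antisymmetric le -> search le bad av r -> search le bad av r' -> r = r'.
Proof.
move=> le_anti sr; elim: sr r' => {av r} [av q fq gq|av q r fq bq _ IH] r' sr'.
  case: sr' fq => [av' q' fq' _|av' q' r'' fq' bq' _] fq.
    exact: first_unique fq fq'.
  by rewrite (first_unique le_anti fq fq') bq' in gq.
case: sr' fq IH => [av' q' fq' gq'|av' q' r'' fq' _ sr''] fq IH.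
  by rewrite -(first_unique le_anti fq fq') bq in gq'.
by apply: IH; rewrite (first_unique le_anti fq fq').
Qed.

(** The loop cannot discard the good candidate [g], so whatever it discards precedes [g]. The
    induction is on the length of a list containing the available predecessors of [g]; each round
    removes one entry. *)
Lemma search_exists (le : rel Q01) (bad : pred Q01) (av : set Q01) (g : Q01) :
  admissible_order le -> av g -> ~~ bad g -> exists r, search le bad av r.
Proof.
move=> adm avg gg; have [_ _ _ le_fin] := adm.
have /finite_seqP[l lg] := le_fin g.
have avl p : av p -> le p g -> p \in l.
  by move=> _ pg; have : [set p | le p g] p by []; rewrite lg.
elim: {l}(size l) {-2}l (leqnn (size l)) {lg} av avg avl => [|n IH] l sl av avg avl.
  case: l sl avl => // _ avl.
  have [q [avq minq]] := first_exists adm (ex_intro _ g avg).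
  by have := avl q avq (minq g avg).
have [q fq] := first_exists adm (ex_intro _ g avg).
have [bq|gq] := boolP (bad q); last by exists q; apply: search_stop.
have ql : q \in l by apply: avl; case: fq => // _; apply.
have [|||r sr] := IH (rem q l) _ (av `\ q); last by exists r; apply: search_next sr.
- by rewrite size_rem // -ltnS prednK //; case: (l) ql.
- by split=> // gq; rewrite gq bq in gg.
- move=> p [avp /eqP pq] pg; have := avl p avp pg.
  by rewrite (perm_mem (perm_to_rem ql)) inE (negPf pq).
Qed.

(** * Infinitude of the rational unit interval and admissible orderings *)

Lemma avoid_seq (l : seq rat) : exists q : Q01, val q \notin l.
Proof.
(* A positive [e] below all positive entries of [l] cannot itself be an entry; each new positive
   entry [a] lowers it to at most [a / 2]. *)
have [e /andP[e0 e1] el] : exists2 e : rat, 0 < e <= 1 &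
    forall r, r \in l -> r <= 0 \/ e < r.
  elim: l => [|a l [e /andP[e0 e1] el]]; first by exists 1.
  have [a0|a0] := lerP a 0.
    by exists e => [|r]; [lra|rewrite inE => /orP[/eqP->|/el]; [left|]].
  exists (Num.min e (a / 2)).
    by rewrite lt_min ge_min e0 e1 /= andbT; lra.
  move=> r; rewrite inE => /orP[/eqP->|/el [|er]]; [right|by left|right].
    by rewrite gt_min; apply/orP; right; lra.
  by rewrite gt_min er.
have eQ : 0 <= e <= 1 by lra.
by exists (Sub e eQ); rewrite SubK; apply/negP => /el []; lra.
Qed.

Lemma infinite_Q01 : infinite_set [set: Q01].
Proof.
move=> /finite_seqP[l lT]; have [q] := avoid_seq (map val l).
by rewrite mem_map; [|exact: val_inj]; have : [set: Q01] q by []; rewrite lT /= => ->.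
Qed.

Lemma leX_admissible : admissible_order leX.
Proof.
split.
- move=> p q; rewrite /leX => /andP[].
  case: ltgtP => //= dpq npq nqp; apply: val_inj; apply/eqP.
  by rewrite rat_eqE dpq eqxx andbT eq_le npq nqp.
- move=> q p r; rewrite /leX.
  case: (ltgtP (denq (val p)) (denq (val q))) => //= [pq _|->].
    by move=> /orP[qr|/andP[/eqP<- _]]; rewrite ?pq // (lt_trans pq qr).
  by case: ltgtP => //= _; apply: le_trans.
- by move=> p q; rewrite /leX; case: ltgtP => //= _; apply: le_total.
- move=> q; set N := `|denq (val q)|%N.
  pose h (p : Q01) := (`|numq (val p)|%N, `|denq (val p)|%N).
  (* Taking absolute values loses nothing, since numerators are nonnegative on the unit interval. *)
  have h_inj : injective h.
    move=> p r [] np dp; apply: val_inj; apply/eqP; rewrite rat_eqE.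
    have num0 (u : Q01) : 0 <= numq (val u).
      by rewrite numq_ge0; case/andP: (valP u).
    rewrite -(gez0_abs (num0 p)) np (gez0_abs (num0 r)) eqxx /=.
    by rewrite -(gtz0_abs (denq_gt0 (val p))) dp (gtz0_abs (denq_gt0 (val r))).
  apply: (@sub_finite_set _ _ (h @^-1` (`I_N.+1 `*` `I_N.+1))); last first.
    apply: finite_preimage => [x y _ _|]; first exact: h_inj.
    by apply: finite_setX; apply: finite_II.
  (* The order bounds the denominator of [p], and [p <= 1] bounds its numerator by that
     denominator. *)
  move=> p /= pq; have dpN : (`|denq (val p)| <= N)%N.
    rewrite -lez_nat !gtz0_abs //.
    by case/orP: pq => [/ltW //|/andP[/eqP-> _]].
  have [p0 p1] := andP (valP p).
  split; rewrite /= ltnS //; apply: leq_trans dpN.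
  rewrite -lez_nat gez0_abs ?numq_ge0 // gtz0_abs //.
  rewrite -(ler_int rat) -[leRHS]mul1r -ler_pdivrMr ?ltr0z //.
  by rewrite divq_num_den.
Qed.

(** Moving [y] to the front of [leX] makes it the value that Initialization assigns; varying [y]
    yields different bijections. *)
Lemma leX_with_first_admissible (y : Q01) :
  let le p q := (p == y) || (q != y) && leX p q in
  admissible_order le /\ is_first le setT y.
Proof.
move=> le; have [X_anti X_trans X_total X_fin] := leX_admissible.
split; last by split=> // p _; rewrite /le eqxx.
split.
- move=> p q; rewrite /le.
  case: (eqVneq p y) (eqVneq q y) => [->|_] [->|_] //=.
  exact: X_anti.
- move=> q p r; rewrite /le.
  case: (eqVneq p y) (eqVneq q y) (eqVneq r y) => [->|_] [->|_] [->|_] //=.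
  exact: X_trans.
- move=> p q; rewrite /le.
  case: (eqVneq p y) (eqVneq q y) => [->|_] [->|_] //=.
- move=> q; apply: (@sub_finite_set _ _ ([set y] `|` [set p | leX p q])).
    by move=> p /orP[/eqP->|/andP[_ pq]]; [left|right].
  by rewrite finite_setU; split; [exact: finite_set1|exact: X_fin].
Qed.

(** * Differences of points and the invariant of the algorithm *)

Definition pdiff (p q : Q01 * Q01) : rat * rat :=
  (Num.sg (val p.1 - val q.1) * (val p.1 - val q.1),
   Num.sg (val p.1 - val q.1) * (val p.2 - val q.2)).

(** The sign factor always subtracts the left point from the right one, so an unordered pair has a
    single difference. *)
Lemma pdiffC (p q : Q01 * Q01) : pdiff p q = pdiff q p.
Proof.
by rewrite /pdiff -(opprB (val q.1)) -(opprB (val q.2)) sgrN !mulrNN.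
Qed.

Lemma pdiff_lt (p q : Q01 * Q01) :
  val q.1 < val p.1 -> pdiff p q = (val p.1 - val q.1, val p.2 - val q.2).
Proof. by move=> qp; rewrite /pdiff gtr0_sg ?subr_gt0 // !mul1r. Qed.

Lemma pdiff_gt (p q : Q01 * Q01) :
  val p.1 < val q.1 -> pdiff p q = (val q.1 - val p.1, val q.2 - val p.2).
Proof. by rewrite pdiffC; exact: pdiff_lt. Qed.

Lemma new_diffsE (s : state) (x y : Q01) :
  new_diffs s x y = [seq pdiff p (x, y) | p <- graph s].
Proof. by []. Qed.

Lemma uniq_map_inj (T U : eqType) (f : T -> U) (l : seq T) :
  uniq (map f l) -> {in l &, injective f}.
Proof.
elim: l => //= a l IH /andP[al ul] p q; rewrite !inE.
move=> /orP[/eqP->|lp] /orP[/eqP->|lq] // fE; last exact: IH.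
  by rewrite fE map_f in al.
by rewrite -fE map_f in al.
Qed.

(** The list [diffs] does not record which pair an entry comes from. [sound_inj] recovers that pair
    from its difference, up to the exchange allowed by [pdiffC]; this is the finite form of the
    Costas property. *)
Record sound (s : state) : Prop := Sound {
  sound_domX : uniq (domX s);
  sound_imgY : uniq (imgY s);
  sound_diffs : uniq (diffs s);
  sound_mem : forall p q, p \in graph s -> q \in graph s -> p != q ->
    pdiff p q \in diffs s;
  sound_inj : forall p q p' q', p \in graph s -> q \in graph s ->
    p' \in graph s -> q' \in graph s -> p != q -> p' != q' ->
    pdiff p q = pdiff p' q' -> (p, q) = (p', q') \/ (p, q) = (q', p')
}.

Lemma sound_functional (s : state) (x y y' : Q01) :
  sound s -> (x, y) \in graph s -> (x, y') \in graph s -> y = y'.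
Proof.
by move=> Ss xy xy'; have [] := uniq_map_inj (sound_domX Ss) xy xy' (erefl x).
Qed.

Lemma sound_injective (s : state) (x x' y : Q01) :
  sound s -> (x, y) \in graph s -> (x', y) \in graph s -> x = x'.
Proof.
by move=> Ss xy x'y; have [] := uniq_map_inj (sound_imgY Ss) xy x'y (erefl y).
Qed.

Lemma sound_singleton (x y : Q01) : sound (State [:: (x, y)] [::]).
Proof.
split=> // [p q|p q p' q']; rewrite !inE; first by move=> /eqP-> /eqP->; rewrite eqxx.
by move=> /eqP-> /eqP->; rewrite eqxx.
Qed.

(** Without conflict, the differences with [(x, y)] are distinct from one another ([new_inj]) and
    from those between older points ([old]). *)
Lemma sound_assign (s : state) (x y : Q01) :
  sound s -> restX s x -> restY s y -> ~~ conflict s x y ->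
  sound (assign s x y).
Proof.
move=> Ss xs ys; rewrite /conflict negbK new_diffsE => uD.
have := uD; rewrite cat_uniq => /and3P[unew /hasPn Dnew _].
have newD p : p \in graph s -> pdiff p (x, y) \notin diffs s.
  move=> ps; apply/negP => /Dnew.
  by rewrite /= (map_f (fun p => pdiff p (x, y))).
have new_inj := uniq_map_inj unew.
split=> /=.
- by rewrite [uniq _]/= (sound_domX Ss) andbT.
- by rewrite [uniq _]/= (sound_imgY Ss) andbT.
- by [].
- move=> p q; rewrite !inE mem_cat new_diffsE.
  move=> /orP[/eqP->|ps] /orP[/eqP->|qs] pq.
  + by rewrite eqxx in pq.
  + by rewrite pdiffC (map_f (fun p => pdiff p (x, y))).
  + by rewrite (map_f (fun p => pdiff p (x, y))).
  + by rewrite (sound_mem Ss) ?orbT.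
have old p q r : p \in graph s -> q \in graph s -> r \in graph s -> q != r ->
    pdiff p (x, y) <> pdiff q r.
  by move=> ps qs rs qr E; have := newD p ps; rewrite E (sound_mem Ss).
move=> p q p' q'; rewrite !inE.
(* In each pair the new point comes first, second or not at all, which leaves nine cases. *)
move=> /orP[/eqP->|ps] /orP[/eqP->|qs] /orP[/eqP->|p's] /orP[/eqP->|q's];
  rewrite ?eqxx // => pq p'q'; rewrite ?(pdiffC (x, y)).
- by move/new_inj => ->//; left.
- by move/new_inj => ->//; right.
- by move/old; case.
- by move/new_inj => ->//; right.
- by move/new_inj => ->//; left.
- by move/old; case.
- by move/esym/old; case.
- by move/esym/old; case.
- exact: (sound_inj Ss).
Qed.

(* Two new differences can coincide only with opposite signs, since equal signs
   give the same point of the graph; hence only sums occur in the second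
   hypothesis. *)
Lemma no_conflict (s : state) (x y : Q01) :
  sound s -> restX s x ->
  (forall p q, p \in graph s -> q \in graph s ->
     val p.1 + val q.1 = val x *+ 2 -> val p.2 + val q.2 = val y *+ 2 ->
     False) ->
  (forall p d, p \in graph s -> d \in diffs s ->
     (val p.1 - val x, val p.2 - val y) != d /\
     (val x - val p.1, val y - val p.2) != d) ->
  ~~ conflict s x y.
Proof.
move=> Ss xs mid off.
have cmp p : p \in graph s -> val p.1 < val x \/ val x < val p.1.
  move=> ps; apply/orP; rewrite -neq_lt; apply/negP => /eqP/val_inj px.
  by move: xs; rewrite /restX /= -px map_f.
rewrite /conflict negbK new_diffsE cat_uniq (sound_diffs Ss) andbT.
apply/andP; split.
  rewrite map_inj_in_uniq; first exact: map_uniq (sound_domX Ss).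
  move=> [p1 p2] [q1 q2] ps qs; have := mid _ _ ps qs; move=> {mid off} /=.
  have [px|px] := cmp _ ps; have [qx|qx] := cmp _ qs;
    rewrite ?(@pdiff_gt _ (x, y) px) ?(@pdiff_lt _ (x, y) px)
            ?(@pdiff_gt _ (x, y) qx) ?(@pdiff_lt _ (x, y) qx) /=.
  - by move=> _ [] /addrI/oppr_inj/val_inj-> /addrI/oppr_inj/val_inj->.
  - by move=> H [] E1 E2; case: H; lra.
  - by move=> H [] E1 E2; case: H; lra.
  - by move=> _ [] /addIr/val_inj-> /addIr/val_inj->.
apply/hasPn => d dD; apply/negP => /mapP[p ps dE].
have [/eqP n1 /eqP n2] := off p d ps dD.
have [px|px] := cmp _ ps; move: dE.
  by rewrite (@pdiff_gt _ (x, y) px) => /esym.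
by rewrite (@pdiff_lt _ (x, y) px) => /esym.
Qed.

(** * Existence of a conflict-free candidate *)

Lemma free_x_exists (s : state) (y : Q01) :
  sound s -> exists2 x, restX s x & ~~ conflict s x y.
Proof.
move=> Ss.
(* In turn: abscissas in use, midpoints, and the solutions of [p1 - x = d1] and of [x - p1 = d1]. *)
have [x] := avoid_seq (map val (domX s) ++
  [seq (val p.1 + val q.1) / 2 | p <- graph s, q <- graph s] ++
  [seq val p.1 - d.1 | p <- graph s, d <- diffs s] ++
  [seq val p.1 + d.1 | p <- graph s, d <- diffs s]).
rewrite !mem_cat !negb_or => /and4P[x1 x2 x3 x4].
have xs : restX s x by rewrite /restX /= -(mem_map val_inj).
exists x => //; apply: no_conflict => //.
  move=> p q ps qs E _; case/negP: x2; apply/allpairsP; exists (p, q).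
  by split=> //=; move: E => /=; lra.
move=> p d ps dD; split; apply/eqP => dE.
  case/negP: x3; apply/allpairsP; exists (p, d).
  by split=> //=; rewrite -dE /=; lra.
case/negP: x4; apply/allpairsP; exists (p, d).
by split=> //=; rewrite -dE /=; lra.
Qed.

(** The sign in a difference depends on abscissas only, so the freshness of [x], which the choice of
    [x] ensured before, is now a hypothesis. *)
Lemma free_y_exists (s : state) (x : Q01) :
  sound s -> restX s x -> exists2 y, restY s y & ~~ conflict s x y.
Proof.
move=> Ss xs.
have [y] := avoid_seq (map val (imgY s) ++
  [seq (val p.2 + val q.2) / 2 | p <- graph s, q <- graph s] ++
  [seq val p.2 - d.2 | p <- graph s, d <- diffs s] ++
  [seq val p.2 + d.2 | p <- graph s, d <- diffs s]).
rewrite !mem_cat !negb_or => /and4P[y1 y2 y3 y4].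
have ys : restY s y by rewrite /restY /= -(mem_map val_inj).
exists y => //; apply: no_conflict => //.
  move=> p q ps qs _ E; case/negP: y2; apply/allpairsP; exists (p, q).
  by split=> //=; move: E => /=; lra.
move=> p d ps dD; split; apply/eqP => dE.
  case/negP: y3; apply/allpairsP; exists (p, d).
  by split=> //=; rewrite -dE /=; lra.
case/negP: y4; apply/allpairsP; exists (p, d).
by split=> //=; rewrite -dE /=; lra.
Qed.

Lemma rest_nonempty (l : seq Q01) : [set x | x \notin l] !=set0.
Proof.
have [x] := avoid_seq (map val l).
by rewrite (mem_map val_inj) => xl; exists x.
Qed.

(** * Existence, uniqueness and monotonicity of runs *)

Section Run.
Variable leY : rel Q01.
Hypothesis leY_adm : admissible_order leY.

Lemma exec_unique (k : kind) (s s1 s2 : state) :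
  exec leY k s s1 -> exec leY k s s2 -> s1 = s2.
Proof.
have [X_anti _ _ _] := leX_admissible; have [Y_anti _ _ _] := leY_adm.
case: k => -[x [y [fx fy ->]]] [x' [y' [fx' fy' ->]]].
- by rewrite (first_unique X_anti fx fx') (first_unique Y_anti fy fy').
- move: fy'; rewrite -(first_unique Y_anti fx fx') => fy'.
  by rewrite (search_unique X_anti fy fy').
- move: fy'; rewrite -(first_unique X_anti fx fx') => fy'.
  by rewrite (search_unique Y_anti fy fy').
Qed.

Lemma exec_exists (k : kind) (s : state) :
  sound s -> exists s', exec leY k s s'.
Proof.
move=> Ss; case: k.
- have [x fx] := first_exists leX_admissible (rest_nonempty [::]).
  have [y fy] := first_exists leY_adm (rest_nonempty [::]).
  exists (State [:: (x, y)] [::]); exists x, y; split=> //.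
    by case: fx => _ fx; split=> // p _; apply: fx.
  by case: fy => _ fy; split=> // p _; apply: fy.
- have [y fy] := first_exists leY_adm (rest_nonempty (imgY s)).
  have [g gs gc] := free_x_exists y Ss.
  have [x sx] := search_exists (bad := conflict s ^~ y) leX_admissible gs gc.
  by exists (assign s x y); exists x, y.
- have [x fx] := first_exists leX_admissible (rest_nonempty (domX s)).
  have [g gs gc] := free_y_exists Ss (proj1 fx).
  have [y sy] := search_exists (bad := conflict s x) leY_adm gs gc.
  by exists (assign s x y); exists x, y.
Qed.

Lemma exec_sound (k : kind) (s s' : state) :
  sound s -> exec leY k s s' -> sound s'.
Proof.
move=> Ss; case: k => -[x [y [fx fy ->]]].
- exact: sound_singleton.
- have [rx cx] := search_mem fy; have [ry _] := fx.
  exact: sound_assign.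
- have [ry cy] := search_mem fy; have [rx _] := fx.
  exact: sound_assign.
Qed.

Variable sigma : nat -> kind.
Hypothesis sigma_adm : admissible_steps sigma.

Lemma run_exists : exists S, is_run leY sigma S.
Proof.
(* The default [s] is never reached: soundness, kept along the run, guarantees that a successor
   exists. *)
pose next k s :=
  if pselect (exists s', exec leY k s s') is left E then projT1 (cid E) else s.
have nextP k s : sound s -> exec leY k s (next k s).
  move=> /(exec_exists k) E; rewrite /next.
  by case: pselect => // E'; exact: projT2 (cid E').
pose S := fix S n := if n is m.+1 then next (sigma m) (S m) else State [::] [::].
have S_sound n : sound (S n).
  by elim: n => [|n IH] //=; apply: exec_sound (nextP _ _ IH).
by exists S; split=> // n; apply: nextP.
Qed.

Lemma run_unique (S S' : nat -> state) :
  is_run leY sigma S -> is_run leY sigma S' -> S = S'.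
Proof.
move=> [S0 SS] [S'0 SS']; apply/funext; elim=> [|n IH]; first by rewrite S0.
by apply: exec_unique (SS n) _; rewrite IH.
Qed.

Variable S : nat -> state.
Hypothesis S_run : is_run leY sigma S.

Lemma run_sound (n : nat) : sound (S n).
Proof.
have [S0 SS] := S_run.
by elim: n => [|n IH]; [rewrite S0|apply: exec_sound (SS n)].
Qed.

Lemma run_sub (m n : nat) : (m <= n)%N -> {subset graph (S m) <= graph (S n)}.
Proof.
have [S0 SS] := S_run; have [init _ _] := sigma_adm.
elim: n => [|n IH]; first by rewrite leqn0 => /eqP->.
rewrite leq_eqVlt => /orP[/eqP->//|]; rewrite ltnS => /IH {}IH p /IH {IH}.
have := SS n; case E : (sigma n) => -[x [y [_ _ ->]]].
(* Initialization overwrites the graph, but it occurs only at step 0, where the graph is empty. *)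
- by move/init: E => ->; rewrite S0.
- by rewrite /= inE => ->; rewrite orbT.
- by rewrite /= inE => ->; rewrite orbT.
Qed.

(** * Every rational is eventually assigned on both sides *)

Lemma step_infinitely_often (k : kind) (N : nat) :
  k <> Initialization -> exists2 n, (N <= n)%N & sigma n = k.
Proof.
move=> kI; have [init nX nY] := sigma_adm; apply: contrapT => H.
(* Starting at [N.+1] skips step 0, so only the other Find step would remain, forever. *)
have others n : (N.+1 <= n)%N -> sigma n <> Initialization /\ sigma n <> k.
  move=> Nn; split; first by move/init => n0; rewrite n0 in Nn.
  by move=> nk; apply: H; exists n => //; apply: ltnW.
case: k kI {H} others => // _ others; [case: nY|case: nX]; exists N.+1 => n;
  by move=> /others; case: (sigma n) => // -[].
Qed.

(** While [x] is missing, the first missing element precedes or equals [x]. Each step granted by the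
    last hypothesis thus absorbs one of the finitely many missing predecessors, listed in [l'],
    until [x] has its turn. *)
Lemma exhaust (le : rel Q01) (D : nat -> seq Q01) :
  admissible_order le ->
  (forall m n, (m <= n)%N -> {subset D m <= D n}) ->
  (forall N, exists n z,
     [/\ (N <= n)%N, is_first le [set x | x \notin D n] z & z \in D n.+1]) ->
  forall x, exists n, x \in D n.
Proof.
move=> [_ _ _ le_fin] D_sub D_step x.
have /finite_seqP[l lx] := le_fin x.
suff H k l' N : (size l' <= k)%N ->
    (forall p, le p x -> p \in l' \/ p \in D N) -> exists n, x \in D n.
  apply: (H _ l 0%N (leqnn _)) => p px; left.
  by have : [set p | le p x] p by []; rewrite lx.
elim: k l' N => [|k IH] l' N sl' lN.
all: have [n [z [Nn [zn minz] zn1]]] := D_step N.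
all: have [|xn] := boolP (x \in D n); first by exists n.
all: have [zl|/(D_sub _ _ Nn) zn'] := lN z (minz x xn); last by move/negP: zn.
  by case: l' sl' zl {lN}.
apply: (IH (rem z l') n.+1); first by rewrite size_rem // -ltnS prednK //; case: (l') zl.
move=> p px; have [|pN] := lN p px; last by right; apply: D_sub pN; apply: leqW.
by rewrite (perm_mem (perm_to_rem zl)) inE => /orP[/eqP->|]; [right|left].
Qed.

(** The steps [FindYforX] are the ones that serve the first unassigned abscissa; [FindXforY] does so
    for ordinates. *)
Lemma run_domX (x : Q01) : exists n, x \in domX (S n).
Proof.
apply: (exhaust leX_admissible (D := domX \o S)) => [m n mn|N].
  by move=> _ /mapP[p pm ->]; apply: map_f; apply: run_sub pm.
have [//|n Nn nk] := @step_infinitely_often FindYforX N.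
have [_ /(_ n)] := S_run; rewrite nk => -[z [y [fz _ Sn]]].
by exists n, z; split=> //; rewrite /= Sn mem_head.
Qed.

Lemma run_imgY (y : Q01) : exists n, y \in imgY (S n).
Proof.
apply: (exhaust leY_adm (D := imgY \o S)) => [m n mn|N].
  by move=> _ /mapP[p pm ->]; apply: map_f; apply: run_sub pm.
have [//|n Nn nk] := @step_infinitely_often FindXforY N.
have [_ /(_ n)] := S_run; rewrite nk => -[x [z [fz _ Sn]]].
by exists n, z; split=> //; rewrite /= Sn mem_head.
Qed.

Lemma run_limit : exists f : Q01 -> Q01,
  forall x y, f x = y <-> exists n, (x, y) \in graph (S n).
Proof.
have /choice[f fS] : forall x, exists y, exists n, (x, y) \in graph (S n).
  by move=> x; have [n /mapP[[x' y] xy ->]] := run_domX x; exists y, n.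
exists f => x y; split=> [<-//|[n xyn]]; have [m xym] := fS x.
apply: (sound_functional (run_sound (maxn m n))).
  exact: run_sub (leq_maxl m n) _ xym.
exact: run_sub (leq_maxr m n) _ xyn.
Qed.

(** * Bijectivity and the Costas property of the limit *)

Section Limit.
Variable f : Q01 -> Q01.
Hypothesis f_lim : forall x y, f x = y <-> exists n, (x, y) \in graph (S n).

(** Injectivity and the Costas property involve finitely many points at a time, so they can be
    checked at one sound stage. *)
Lemma limit_graph (l : seq Q01) :
  exists n, forall x, x \in l -> (x, f x) \in graph (S n).
Proof.
elim: l => [|a l [n nl]]; first by exists 0%N.
have [m am] := (f_lim a (f a)).1 erefl.
exists (maxn m n) => x; rewrite inE => /orP[/eqP->|/nl xn].
  exact: run_sub (leq_maxl m n) _ am.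
exact: run_sub (leq_maxr m n) _ xn.
Qed.

Lemma limit_bijective : bijective f.
Proof.
have f_inj x x' : f x = f x' -> x = x'.
  move=> fE; have [n nP] := limit_graph [:: x; x'].
  apply: (sound_injective (run_sound n) (y := f x)); last rewrite fE.
    by apply: nP; rewrite !inE eqxx.
  by apply: nP; rewrite !inE eqxx orbT.
have /choice[g fg] : forall y, exists x, f x = y.
  move=> y; have [n /mapP[[x y'] xy ->]] := run_imgY y.
  by exists x; apply/f_lim; exists n.
by exists g => // x; apply: f_inj; rewrite fg.
Qed.

Lemma limit_costas : costas f.
Proof.
move=> [x y] [x' y']; rewrite !inE /= => yx y'x' [dE fE].
have [n nP] := limit_graph [:: x; y; x'; y'].
have mem z : z \in [:: x; y; x'; y'] -> (z, f z) \in graph (S n) by exact: nP.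
have ne u v : val v < val u -> (u, f u) != (v, f v).
  by move=> vu; apply: contraTN vu => /eqP[-> _]; rewrite ltxx.
have [||||||||] := sound_inj (run_sound n) (p := (x, f x)) (q := (y, f y))
  (p' := (x', f x')) (q' := (y', f y')).
- by apply: mem; rewrite !inE eqxx.
- by apply: mem; rewrite !inE eqxx ?orbT.
- by apply: mem; rewrite !inE eqxx ?orbT.
- by apply: mem; rewrite !inE eqxx ?orbT.
- exact: ne.
- exact: ne.
- by rewrite !pdiff_lt //= dE fE.
- by case=> -> _ -> _.
(* The exchanged pair is impossible, as both pairs are listed with the larger abscissa first. *)
- by case=> xy' _ yx' _; move: yx y'x'; rewrite xy' yx' => /ltW; rewrite leNgt => /negbTE->.
Qed.

End Limit.

End Run.

Theorem theorem8 :
  (forall (leY : rel Q01) (sigma : nat -> kind),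
     admissible_order leY -> admissible_steps sigma ->
     (exists! f : Q01 -> Q01, produces leY sigma f) /\
     (forall f : Q01 -> Q01, produces leY sigma f ->
        bijective f /\ costas f)) /\
  infinite_set [set f : Q01 -> Q01 |
    [/\ bijective f, costas f &
        exists (leY : rel Q01) (sigma : nat -> kind),
          [/\ admissible_order leY, admissible_steps sigma &
              produces leY sigma f]]].
Proof.
have main leY sigma : admissible_order leY -> admissible_steps sigma ->
    (exists! f, produces leY sigma f) /\
    (forall f, produces leY sigma f -> bijective f /\ costas f).
  move=> leY_adm sigma_adm; split; last first.
    move=> f [S S_run f_lim]; split.
      exact: (limit_bijective leY_adm sigma_adm S_run f_lim).
    exact: (limit_costas sigma_adm S_run f_lim).
  have [S S_run] := run_exists leY_adm sigma.
  have [f f_lim] := run_limit sigma_adm S_run.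
  exists f; split; first by exists S.
  move=> g [S' S'_run g_lim]; apply/funext => x; apply/f_lim.
  by rewrite (run_unique leY_adm S_run S'_run); apply/g_lim.
split=> //.
have [x0 fx0] := first_exists leX_admissible (rest_nonempty [::]).
(* Evaluation at [x0] would map a finite set of bijections onto all of [Q01]. *)
move=> /(finite_image (fun f => f x0)) fin.
apply: infinite_Q01; apply: sub_finite_set fin => y _.
have [leY_adm fy] := leX_with_first_admissible y; set leY := fun _ _ => _ in leY_adm fy.
pose sigma n :=
  if n is 0%N then Initialization else if odd n then FindXforY else FindYforX.
have sigma_adm : admissible_steps sigma.
  split.
  - by case=> [|n] //; split=> //; rewrite /sigma; case: (odd _).
  (* Beyond any [N], the even index [N.*2.+2] is a [FindYforX] step and the odd index [N.*2.+1] a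
     [FindXforY] step. *)
  - case=> N /(_ N.*2.+2); rewrite /sigma /= odd_double => H.
    by have /H : (N <= N.*2.+2)%N by lia.
  - case=> N /(_ N.*2.+1); rewrite /sigma /= odd_double => H.
    by have /H : (N <= N.*2.+1)%N by lia.
have [[f [f_prod _]] prodP] := main leY sigma leY_adm sigma_adm.
have [f_bij f_costas] := prodP f f_prod.
exists f; first by split=> //; exists leY, sigma.
(* The pair [(x0, y)] is already present after Initialization, in state [S 1]. *)
have [S S_run f_lim] := f_prod; apply/f_lim; exists 1%N.
have [_ /(_ 0%N) [x [y' [fx fy' ->]]]] := S_run.
have [[X_anti _ _ _] [Y_anti _ _ _]] := (leX_admissible, leY_adm).
rewrite /= (first_unique Y_anti fy' fy) (first_unique X_anti fx (q := x0)) ?mem_head //.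
by case: fx0 => _ fx0; split=> // p _; apply: fx0.
Qed.
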